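(* Let $r\in\mathbb{N}$ and let $G$ be an $r$-regular simple graph with girth $5$ and diameter $2$. Let $n:=|V(G)|$ and $m:=|E(G)|$. Then (a) $\displaystyle i_3(G)=\binom{n}{3}-(n-2)m+n\binom{r}{2}$; (b) $\displaystyle i_4(G)=\binom{n}{4}-\binom{n-2}{2}m+n(n-4)\binom{r}{2}-n\binom{r}{3}+\binom{m}{2}-m(r-1)^2$. In particular, if a $57$-regular graph $G$ of diameter $2$ and girth $5$ exists, then $G$ must have exactly $2^6\cdot 3\cdot 5^2\cdot 7^2\cdot 13\cdot 19$ pentagons, exactly $2^3\cdot 3\cdot 5^4\cdot 7\cdot 11\cdot 13\cdot 19^2$ independent sets of size three, and exactly $2^2\cdot 5^4\cdot 7\cdot 11\cdot 13\cdot 19\cdot 87751$ independent sets of size four.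
   Context: All graphs are finite and simple. $i_t(G)$ denotes the number of independent sets of $G$ of size exactly $t$. The girth of $G$ is the length of its shortest cycle; the diameter of $G$ is the maximum over pairs of vertices of the length (number of edges) of a shortest path between them. The number of pentagons of $G$ is the number of vertex subsets $J\subseteq V(G)$ such that the induced subgraph $G[J]$ is isomorphic to the 5-cycle $C_5$. *)

(* Defs.v *)
From HB Require Import structures.
From mathcomp Require Import all_boot all_order all_algebra.

Set Implicit Arguments.
Unset Strict Implicit.
Unset Printing Implicit Defensive.

Record sgraph := SGraph {
  vertex :> finType;
  adj : rel vertex;
  adj_sym : symmetric adj;
  adj_irrefl : irreflexive adj
}.

Definition edges (G : sgraph) : {set {set G}} :=
  [set A : {set G} | [exists x : G, exists y : G, adj x y && (A == [set x; y])]].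

Definition regular (G : sgraph) (r : nat) : Prop :=
  forall x : G, #|[set y : G | adj x y]| = r.

Definition independent (G : sgraph) (S : {set G}) : bool :=
  [forall x in S, forall y in S, ~~ adj x y].

Definition num_indep (G : sgraph) (t : nat) : nat :=
  #|[set S : {set G} | independent S & #|S| == t]|.

(* [:: x_1; ...; x_k] stands for the cycle x_1 ... x_k x_1; the bound on the
   size excludes the closed walks of length at most 2 accepted by [cycle]. *)
Definition is_cycle (G : sgraph) (c : seq G) : bool :=
  [&& 2 < size c, uniq c & cycle (@adj G) c].

(* Relational, so that it fails for every [g] when [G] has no cycle. *)
Definition has_girth (G : sgraph) (g : nat) : Prop :=
  (exists2 c : seq G, is_cycle c & size c = g) /\
  (forall c : seq G, is_cycle c -> g <= size c).

(* The path runs through [x :: p], so that it has [size p] edges. *)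
Definition is_path (G : sgraph) (x y : G) (p : seq G) : bool :=
  [&& path (@adj G) x p, uniq (x :: p) & last x p == y].

Definition has_dist (G : sgraph) (x y : G) (d : nat) : Prop :=
  (exists2 p : seq G, is_path x y p & size p = d) /\
  (forall p : seq G, is_path x y p -> d <= size p).

(* Fails for every [d] when [G] is empty or disconnected. *)
Definition has_diameter (G : sgraph) (d : nat) : Prop :=
  (forall x y : G, exists2 k : nat, has_dist x y k & k <= d) /\
  (exists x y : G, has_dist x y d).

Definition isomorphic (T1 T2 : finType) (e1 : rel T1) (e2 : rel T2) : bool :=
  [exists f : {ffun T1 -> T2},
    [&& injectiveb f, [forall y : T2, y \in codom f]
      & [forall x : T1, forall y : T1, e2 (f x) (f y) == e1 x y]]].

Definition induced (G : sgraph) (J : {set G}) : rel {x : G | x \in J} :=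
  fun x y => adj (val x) (val y).

Definition cycle_rel (k : nat) : rel 'I_k :=
  fun i j => (j == i.+1 %% k :> nat) || (i == j.+1 %% k :> nat).

Definition num_pentagons (G : sgraph) : nat :=
  #|[set J : {set G} | isomorphic (@induced G J) (@cycle_rel 5)]|.

(* Main.v *)
Require Import Defs.
From mathcomp Require Import all_boot all_order all_algebra.
From mathcomp Require Import zify ring.
From Stdlib Require PeanoNat.

(** Girth 5 forbids triangles and makes common neighbours of two vertices
    unique; diameter 2 makes them exist for non-adjacent vertices.  So [G] is
    strongly regular with parameters [(r, 0, 1)] ([moore_strongly_regular]),
    and summing the numbers of common neighbours with a fixed vertex gives
    [n = r ^ 2 + 1] ([moore_order]).  From here on, every count in the theorem
    is a polynomial in [r].

    Independent sets are counted by extension: choosing one vertex of an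
    independent set of size [t + 1] and removing it gives
    [(t + 1) * i_(t + 1) = \sum_S (n - |N[S]|)], where [S] runs over the
    independent sets of size [t] ([num_indep_step]).  Two distinct non-adjacent
    vertices have closed neighbourhoods of size [r + 1] meeting in one point,
    so [|N[S]|] is [r + 1] for [t = 1] and [2 * r + 1] for [t = 2].  For [t = 3]
    inclusion-exclusion gives [3 * r] plus the number (0 or 1) of vertices
    adjacent to all of [S] ([card_outside3]).  The sum of these corrections is
    the number of 3-subsets of neighbourhoods, [n * 'C(r, 3)], since every
    neighbourhood is independent ([sum_common_nbrs]).  The formulas (a) and (b)
    are then polynomial identities, using [2 * m = n * r], which comes from
    [i_2 + m = 'C(n, 2)].

    Pentagons are counted with their arcs, the ordered pairs of adjacent
    vertices.  A pentagon has 10 arcs ([card_pentagon_arcs]).  An arc [(b, c)]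
    lies on exactly [(r - 1) ^ 2] pentagons ([card_pentagons_arc]): choose
    [a <> c] next to [b] and [d <> b] next to [c]; then [a] and [d] are distinct
    and non-adjacent, and their unique common neighbour closes the path
    [a b c d].  As [G] has [n * r] arcs, there are [n * r * (r - 1) ^ 2 / 10]
    pentagons ([num_pentagons_arcs]). *)

Set Implicit Arguments.
Unset Strict Implicit.
Unset Printing Implicit Defensive.

(** * Moore graphs of diameter 2 are strongly regular *)

Definition nbr (G : sgraph) (x : G) : {set G} := [set y | adj x y].

Definition cnbr (G : sgraph) (x : G) : {set G} := x |: nbr x.

Definition strongly_regular (G : sgraph) (k l u : nat) : Prop :=
  [/\ forall x : G, #|nbr x| = k,
      forall x y : G, adj x y -> #|nbr x :&: nbr y| = l
    & forall x y : G, x != y -> ~~ adj x y -> #|nbr x :&: nbr y| = u].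

Lemma adj_neq (G : sgraph) (x y : G) : adj x y -> x != y.
Proof. by apply: contraTneq => ->; rewrite adj_irrefl. Qed.

Lemma girth5_triangle_free (G : sgraph) (x y z : G) :
  has_girth G 5 -> adj x y -> adj x z -> ~~ adj y z.
Proof.
case=> _ minc xy xz; apply/negP => yz.
suff /minc : is_cycle [:: x; y; z] by [].
rewrite /is_cycle /= !inE negb_or !adj_neq //= xy yz.
by rewrite adj_sym xz.
Qed.

(** Two common neighbours [a], [b] would close the 4-cycle [x a y b]. *)
Lemma girth5_common_nbr_uniq (G : sgraph) (x y a b : G) :
  has_girth G 5 -> x != y -> adj x a -> adj y a -> adj x b -> adj y b -> a = b.
Proof.
case=> _ minc nxy xa ya xb yb; apply/eqP; apply/negPn/negP => nab.
suff /minc : is_cycle [:: x; a; y; b] by [].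
rewrite /is_cycle /= !inE !negb_or !(adj_neq xa) nxy (adj_neq xb) nab (adj_neq yb).
by rewrite xa yb (adj_sym a) ya (adj_sym b) xb eq_sym (adj_neq ya).
Qed.

Lemma diam2_common_nbr (G : sgraph) (x y : G) :
  has_diameter G 2 -> x != y -> ~~ adj x y -> exists z, adj x z && adj z y.
Proof.
case=> dist _ nxy axy; case: (dist x y) => d [[p /and3P[pp _ /eqP lp] sp] _] d2.
case: p sp pp lp => [|a [|b [|c p]]] /= sp pp lp.
- by rewrite lp eqxx in nxy.
- by rewrite -lp; move: axy; rewrite -lp; case/andP: pp => ->.
- by exists a; rewrite -lp; case/and3P: pp => -> ->.
- by move: d2; rewrite -sp.
Qed.

(** For a non-adjacent pair the diameter gives a common neighbour, and the
    absence of 4-cycles makes it the only one. *)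
Lemma moore_strongly_regular (G : sgraph) (r : nat) :
  regular G r -> has_girth G 5 -> has_diameter G 2 -> strongly_regular G r 0 1.
Proof.
move=> regG girthG diamG; split=> [x|x y xy|x y nxy axy]; first exact: regG.
  apply/eqP; rewrite cards_eq0 -subset0; apply/subsetP => z; rewrite !inE.
  by case/andP=> xz; rewrite (negbTE (girth5_triangle_free girthG xy xz)).
have [z /andP[xz zy]] := diam2_common_nbr diamG nxy axy.
apply/eqP/cards1P; exists z; apply/setP => w; rewrite !inE.
apply/andP/eqP => [[xw yw]|->]; last by rewrite xz adj_sym.
by apply: (girth5_common_nbr_uniq girthG nxy) => //; rewrite adj_sym.
Qed.

(** Both sides count the edges between [A] and [B] by one endpoint. *)
Lemma sum_card_nbrI (G : sgraph) (A B : {set G}) :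
  \sum_(x in A) #|nbr x :&: B| = \sum_(y in B) #|nbr y :&: A|.
Proof.
have E (C D : {set G}) : \sum_(x in C) #|nbr x :&: D|
    = \sum_(x in C) \sum_(y in D) adj x y.
  apply: eq_bigr => x _; rewrite -sum1_card big_mkcond [RHS]big_mkcond /=.
  by apply: eq_bigr => y _; rewrite !inE; case: (adj x y); case: (y \in D).
rewrite !E exchange_big; apply: eq_bigr => y _.
by apply: eq_bigr => x _; rewrite adj_sym.
Qed.

(** * Extending independent sets by one vertex *)

Definition indep_sets (G : sgraph) (t : nat) : {set {set G}} :=
  [set S : {set G} | independent S & #|S| == t].

Definition outside (G : sgraph) (S : {set G}) : {set G} :=
  [set v | [forall x in S, v \notin cnbr x]].

Lemma independentP (G : sgraph) (S : {set G}) :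
  reflect {in S &, forall x y, ~~ adj x y} (independent S).
Proof.
by apply: (iffP forall_inP) => [H x y xS yS|H x xS];
  [have /forall_inP := H x xS; apply | apply/forall_inP => y yS; exact: H].
Qed.

Lemma independentU1 (G : sgraph) (S : {set G}) (v : G) :
  (independent (v |: S) && (v \notin S)) = (independent S && (v \in outside S)).
Proof.
apply/idP/idP => [/andP[/independentP iS nv]|/andP[/independentP iS]].
  apply/andP; split.
    by apply/independentP => x y xS yS; apply: iS; rewrite !inE ?xS ?yS orbT.
  rewrite inE; apply/forall_inP => x xS; rewrite !inE negb_or.
  by rewrite (memPnC nv) // iS // !inE ?xS ?eqxx ?orbT.
rewrite inE => /forall_inP vS; apply/andP; split; last first.
  by apply/negP => /vS; rewrite !inE eqxx.
have vS' x : x \in S -> ~~ adj x v by move/vS; rewrite !inE negb_or => /andP[].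
apply/independentP => x y; rewrite !inE => /predU1P[->|xS] /predU1P[->|yS].
- by rewrite adj_irrefl.
- by rewrite adj_sym vS'.
- exact: vS'.
- exact: iS.
Qed.

(** Both sides count the pairs of an independent set of size [t + 1] and one
    of its vertices [v]: on the right, [S] is what is left after deleting [v]. *)
Lemma num_indep_step (G : sgraph) (t : nat) :
  t.+1 * num_indep G t.+1 = \sum_(S in indep_sets G t) #|outside S|.
Proof.
rewrite /num_indep mulnC -sum_nat_const.
transitivity (\sum_(T in indep_sets G t.+1) \sum_(v in T) 1).
  by apply: eq_bigr => T; rewrite inE => /andP[_ /eqP <-]; rewrite sum1_card.
under [RHS]eq_bigr do rewrite -sum1_card.
rewrite (exchange_big_dep predT) //= [RHS](exchange_big_dep predT) //=.
apply: eq_bigr => v _.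
rewrite (reindex_onto (setU [set v]) (fun T => T :\ v)) /=; last first.
  by move=> T /andP[_ vT]; rewrite setD1K.
apply: eq_bigl => S; rewrite !inE eqxx andbT.
have -> : ((v |: S) :\ v == S) = (v \notin S).
  by apply/eqP/idP => [<-|/setU1K//]; rewrite !inE eqxx.
have := independentU1 S v; rewrite inE cardsU1; case: (v \notin S).
  by rewrite !andbT add1n eqSS => ->; rewrite andbAC.
by rewrite !andbF andbAC => <-.
Qed.

(** The form in which [num_indep_step] is applied: [c S] is the size of the
    closed neighbourhood of [S], kept on the left to avoid truncated
    subtraction. *)
Lemma num_indep_rec (G : sgraph) (t : nat) (c : {set G} -> nat) :
  {in indep_sets G t, forall S, #|outside S| + c S = #|G|} ->
  t.+1 * num_indep G t.+1 + \sum_(S in indep_sets G t) c S = #|G| * num_indep G t.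
Proof.
move=> cS; rewrite num_indep_step -big_split /= (eq_bigr (fun=> #|G|) cS).
by rewrite sum_nat_const mulnC.
Qed.

(** * Pentagons as labelled 5-cycles *)

Lemma card_rel (T : finType) (e : rel T) :
  #|[set q : T * T | e q.1 q.2]| = \sum_(x : T) #|[set y | e x y]|.
Proof.
under [RHS]eq_bigr do rewrite -sum1_card.
rewrite pair_big_dep -sum1_card; apply: eq_bigl => q.
by rewrite !inE.
Qed.

Definition is_pentagon (G : sgraph) (J : {set G}) : bool :=
  isomorphic (@induced G J) (@cycle_rel 5).

(** The inverse of an isomorphism from the subgraph induced on [J] to the
    5-cycle; valued in [G], it avoids the subtype of vertices of [J]. *)
Definition labelling (G : sgraph) (J : {set G}) (p : 'I_5 -> G) : Prop :=
  [/\ injective p, J = [set p i | i : 'I_5]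
    & forall i j, adj (p i) (p j) = cycle_rel i j].

Lemma pentagonP (G : sgraph) (J : {set G}) :
  is_pentagon J <-> exists p, labelling J p.
Proof.
split=> [/existsP[f /and3P[/injectiveP injf /forallP surj /forallP homf]]|].
  pose g i := iinv (surj i); have fg i : f (g i) = i by exact: f_iinv.
  exists (fun i => val (g i)); split=> [i j /val_inj/(congr1 f)||i j].
  - by rewrite !fg.
  - apply/setP => x; apply/idP/imsetP => [xJ|[i _ ->]]; last exact: valP.
    by exists (f (Sub x xJ)) => //; rewrite (injf _ (Sub x xJ) (fg _)).
  - rewrite -[in RHS](fg i) -[in RHS](fg j).
    by have /forallP/(_ (g j))/eqP -> := homf (g i).
case=> p [injp eJ homp].
have ex (u : {x | x \in J}) : exists i, p i == val u.
  have : val u \in [set p i | i : 'I_5] by rewrite -eJ; exact: valP.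
  by case/imsetP=> i _ ->; exists i.
pose f := [ffun u => xchoose (ex u)].
have pf u : p (f u) = val u by rewrite ffunE; apply/eqP; exact: (xchooseP (ex u)).
apply/existsP; exists f; apply/and3P; split.
- by apply/injectiveP => u v fuv; apply: val_inj; rewrite -!pf fuv.
- apply/forallP => i; have iJ : p i \in J by rewrite eJ imset_f.
  by apply/codomP; exists (Sub (p i) iJ); apply: injp; rewrite pf.
- apply/forallP => u; apply/forallP => v.
  by rewrite -homp !pf.
Qed.

Lemma card_pentagon_arcs (G : sgraph) (J : {set G}) : is_pentagon J ->
  #|[set q : G * G | adj q.1 q.2 & (q.1 \in J) && (q.2 \in J)]| = 10.
Proof.
case/pentagonP=> p [injp eJ homp].
have -> : [set q : G * G | adj q.1 q.2 & (q.1 \in J) && (q.2 \in J)]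
   = [set (p q.1, p q.2) | q in [set q : 'I_5 * 'I_5 | cycle_rel q.1 q.2]].
  apply/setP => -[x y]; rewrite inE /= eJ.
  apply/and3P/imsetP => [[xy /imsetP[i _ ex] /imsetP[j _ ey]]|[[i j]]].
    by exists (i, j); rewrite ?inE /= -?homp -ex -?ey.
  by rewrite inE /= => ij [-> ->]; rewrite homp ij !imset_f.
rewrite card_imset => [|[i j] [k l] [/injp -> /injp ->]] //.
rewrite card_rel; under eq_bigr do rewrite -sum1_card big_mkcond.
by rewrite !big_ord_recl !big_ord0 /= !inE.
Qed.

(** Distinct vertices of the 5-cycle have distinct neighbourhoods.  Hence a map
    from it that preserves and reflects adjacency is injective. *)
Lemma C5_twin_free (i j : 'I_5) : cycle_rel i =1 cycle_rel j -> i = j.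
Proof.
move=> Hij; have := (Hij ord0, Hij (@Ordinal 5 1 isT), Hij (@Ordinal 5 2 isT),
                     Hij (@Ordinal 5 3 isT), Hij (@Ordinal 5 4 isT)).
rewrite /cycle_rel /= => Eij; apply/val_inj; move: Eij.
case: i j {Hij} => [[|[|[|[|[|i]]]]] // iP] [[|[|[|[|[|j]]]]] // jP] //=;
  by do ![case].
Qed.

(** An arc [(i, j)] of the 5-cycle determines the other three vertices: [i'] and
    [j'] continue it at its two ends and [k] is opposite to it. *)
Lemma C5_arc (i j : 'I_5) : cycle_rel i j -> exists i' j' k : 'I_5,
  [/\ [&& cycle_rel i i', cycle_rel j j', cycle_rel i' k & cycle_rel j' k],
      i' != j, j' != i & forall l, l \in [:: i'; i; j; j'; k]].
Proof.
(* Modulo 5 these are [2 i - j], [2 j - i] and the antipode [3 (i + j)]. *)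
move=> ij; exists (inZp (2 * i + 4 * j)), (inZp (4 * i + 2 * j)), (inZp (3 * i + 3 * j)).
by case: i j ij => [[|[|[|[|[|i]]]]] // iP] [[|[|[|[|[|j]]]]] // jP] // _;
  split; rewrite // => -[[|[|[|[|[|l]]]]] // lP].
Qed.

(** * Independent sets in strongly regular graphs with parameters (r, 0, 1) *)

Section Moore.
Variables (G : sgraph) (r : nat).
Hypothesis srgG : strongly_regular G r 0 1.

Lemma card_nbr (x : G) : #|nbr x| = r.
Proof. by case: srgG. Qed.

Lemma triangle_free (x y z : G) : adj x y -> adj x z -> adj y z = false.
Proof.
case: srgG => _ tf _ xy xz; apply/negP => yz.
have /eqP := tf _ _ yz; rewrite cards_eq0 => /eqP/setP/(_ x).
by rewrite !inE !(adj_sym _ x) xy xz.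
Qed.

Lemma common_nbr (x y : G) :
  x != y -> ~~ adj x y -> exists z, nbr x :&: nbr y = [set z].
Proof. by case: srgG => _ _ mu nxy axy; apply/cards1P; rewrite mu. Qed.

(** Sum over all vertices [y] the number of common neighbours of [x] and [y].
    Counted from the neighbours of [x] the total is [r ^ 2]; counted from [y], it
    is [r] for [y = x], 0 for [y] adjacent to [x] and 1 for the other [n - 1 - r]
    vertices. *)
Lemma moore_order (x : G) : #|G| = r ^ 2 + 1.
Proof.
have := sum_card_nbrI (nbr x) setT.
under eq_bigr do rewrite setIT card_nbr.
rewrite sum_nat_const card_nbr => H.
have E : \sum_(y in [set: G]) #|nbr y :&: nbr x| = r + #|~: cnbr x|.
  rewrite (bigD1 x) ?inE //= setIid card_nbr; congr addn.
  rewrite (bigID [in nbr x]) /= big1 ?add0n => [|y]; last first.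
    case/andP=> _; rewrite inE => xy; case: srgG => _ tf _.
    by rewrite tf // adj_sym.
  rewrite -sum1_card; apply: eq_big => [y|y]; first by rewrite !inE /= negb_or.
  case/andP=> /andP[_ nyx]; rewrite inE => axy; case: srgG => _ _ -> //.
  by rewrite adj_sym.
have := cardsC (cnbr x); rewrite /cnbr cardsU1 card_nbr inE adj_irrefl /=.
move: H E; rewrite /cnbr; lia.
Qed.

Lemma card_cnbr (x : G) : #|cnbr x| = r.+1.
Proof. by rewrite cardsU1 card_nbr inE adj_irrefl. Qed.

Lemma cnbrI (x y : G) :
  x != y -> ~~ adj x y -> cnbr x :&: cnbr y = nbr x :&: nbr y.
Proof.
move=> nxy axy; apply/setP => z; rewrite !inE.
case: eqVneq => [->|_]; first by rewrite (negbTE nxy) adj_irrefl adj_sym (negbTE axy).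
by case: eqVneq => [->|//]; rewrite (negbTE axy).
Qed.

Lemma card_cnbrI (x y : G) :
  x != y -> ~~ adj x y -> #|cnbr x :&: cnbr y| = 1.
Proof. by move=> nxy axy; rewrite cnbrI //; case: srgG => _ _ ->. Qed.

Lemma card_cnbrU (x y : G) :
  x != y -> ~~ adj x y -> #|cnbr x :|: cnbr y| = 2 * r + 1.
Proof. by move=> nxy axy; rewrite cardsU card_cnbrI // !card_cnbr; lia. Qed.

Lemma num_indep0 : num_indep G 0 = 1.
Proof.
rewrite -(cards1 (set0 : {set G})); congr #|pred_of_set _|; apply/setP => S.
rewrite !inE cards_eq0 andb_idl // => /eqP ->.
by apply/independentP => x y; rewrite inE.
Qed.

Lemma num_indep1 : num_indep G 1 = #|G|.
Proof.
have := @num_indep_rec G 0 (fun=> 0).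
rewrite num_indep0 big1 // mul1n addn0 muln1; apply=> S.
rewrite inE cards_eq0 => /andP[_ /eqP ->]; rewrite -cardsT addn0.
by apply: eq_card => v; rewrite !inE; apply/forall_inP => x; rewrite inE.
Qed.

Lemma num_indep2 : 2 * num_indep G 2 + r.+1 * #|G| = #|G| * #|G|.
Proof.
have := @num_indep_rec G 1 (fun=> r.+1).
rewrite sum_nat_const [#|_|]num_indep1 num_indep1 [#|_| * r.+1]mulnC; apply=> S.
rewrite inE => /andP[_ /cards1P[x ->]]; rewrite -(card_cnbr x) addnC -(cardsC (cnbr x)).
congr addn; apply: eq_card => v; rewrite [in LHS]inE in_setC.
by apply/forall_inP/idP => [|H y /set1P ->//]; apply; rewrite inE.
Qed.

Lemma num_indep3 :
  3 * num_indep G 3 + (2 * r + 1) * num_indep G 2 = #|G| * num_indep G 2.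
Proof.
have := @num_indep_rec G 2 (fun=> 2 * r + 1).
rewrite sum_nat_const -/(num_indep G 2) [num_indep G 2 * (_ + 1)]mulnC; apply=> S.
rewrite inE => /andP[/independentP iS /cards2P[x [y [nxy eS]]]].
have axy : ~~ adj x y by apply: iS; rewrite eS !inE eqxx ?orbT.
rewrite -(card_cnbrU nxy axy) addnC -(cardsC (cnbr x :|: cnbr y)).
congr addn; apply: eq_card => v; rewrite [in LHS]inE in_setC in_setU eS.
rewrite negb_or; apply/forall_inP/andP => [H|[Hx Hy] z].
  by split; apply: H; rewrite !inE eqxx ?orbT.
by case/set2P=> ->.
Qed.

(** Exchange the sums: [v] is adjacent to all of [S] when [S] is a 3-subset of
    the neighbourhood of [v], and every such subset is independent because there
    are no triangles. *)
Lemma sum_common_nbrs :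
  \sum_(S in indep_sets G 3) #|[set v | S \subset nbr v]| = #|G| * 'C(r, 3).
Proof.
under eq_bigr do rewrite -sum1_card.
rewrite (exchange_big_dep predT) //= -sum_nat_const.
apply: eq_big => // v _.
rewrite -(card_nbr v) -cards_draws -sum1_card; apply: eq_bigl => S; rewrite !inE.
rewrite andbC andbCA andb_idl // => /andP[/subsetP Sv _].
apply/independentP => x y /Sv; rewrite inE => vx /Sv; rewrite inE => vy.
by rewrite (triangle_free vx vy).
Qed.

(** Inclusion-exclusion for three closed neighbourhoods of size [r + 1] that
    pairwise meet in one point.  Their common points are the vertices adjacent
    to all of [S], as no vertex of [S] is adjacent to another one. *)
Lemma card_outside3 (S : {set G}) : S \in indep_sets G 3 ->
  #|outside S| + (3 * r + #|[set v | S \subset nbr v]|) = #|G|.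
Proof.
rewrite inE => /andP[/independentP iS cS].
have [a aS] : exists a, a \in S by apply/card_gt0P; rewrite (eqP cS).
have /cards2P[b [c [nbc eS]]] : #|S :\ a| == 2.
  by move: cS; rewrite (cardsD1 a) aS.
have /and3P[nab nac nbc'] : [&& a != b, a != c & b != c].
  have : b \in S :\ a by rewrite eS !inE eqxx.
  have : c \in S :\ a by rewrite eS !inE eqxx orbT.
  by rewrite !inE !(eq_sym a) nbc => /andP[-> _] /andP[-> _].
have bS : b \in S by apply: (subsetP (subsetDl S [set a])); rewrite eS !inE eqxx.
have cS' : c \in S by apply: (subsetP (subsetDl S [set a])); rewrite eS !inE eqxx orbT.
have {}eS : S = [set a; b; c] by rewrite -(setD1K aS) eS setUA.
have iab := iS _ _ aS bS; have iac := iS _ _ aS cS'; have ibc := iS _ _ bS cS'.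
have -> : outside S = ~: (cnbr a :|: cnbr b :|: cnbr c).
  apply/setP => v; rewrite inE in_setC 2!in_setU 2!negb_or.
  apply/forall_inP/idP => [H|/andP[/andP[ha hb] hc] z].
    by rewrite (H a aS) (H b bS) (H c cS').
  by rewrite eS => /setUP[/set2P[]|/set1P] ->.
have -> : [set v | S \subset nbr v] = (cnbr a :&: cnbr c) :&: (cnbr b :&: cnbr c).
  rewrite !cnbrI //; apply/setP => v; rewrite eS !inE !subUset !sub1set !inE.
  by rewrite !(adj_sym v); case: (adj a v); case: (adj b v); case: (adj c v).
have := cardsC (cnbr a :|: cnbr b :|: cnbr c).
have := cardsUI (cnbr a :|: cnbr b) (cnbr c).
have := cardsUI (cnbr a :&: cnbr c) (cnbr b :&: cnbr c).
rewrite -setIUl card_cnbrU // !card_cnbrI // card_cnbr; lia.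
Qed.

Lemma num_indep4 :
  4 * num_indep G 4 + (3 * r * num_indep G 3 + #|G| * 'C(r, 3))
  = #|G| * num_indep G 3.
Proof.
have := num_indep_rec card_outside3.
rewrite big_split /= sum_common_nbrs sum_nat_const -/(num_indep G 3).
by rewrite [num_indep G 3 * _]mulnC.
Qed.

(** A 2-subset is either independent or an edge. *)
Lemma num_indep2_edges : num_indep G 2 + #|edges G| = 'C(#|G|, 2).
Proof.
rewrite -card_draws -(cardsID [set S : {set G} | independent S]); congr (_ + _).
  by congr #|pred_of_set _|; apply/setP => S; rewrite !inE andbC.
congr #|pred_of_set _|; apply/setP => S; rewrite !inE.
apply/existsP/andP => [[x /existsP[y /andP[xy /eqP ->]]]|].
  rewrite cards2 (adj_neq xy); split=> //; apply/negP => /independentP/(_ x y).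
  by rewrite !inE !eqxx orbT xy => /(_ isT isT).
case=> nS /cards2P[x [y [nxy eS]]]; exists x; apply/existsP; exists y.
rewrite eS eqxx andbT; apply: contraR nS => axy.
apply/independentP => u v; rewrite eS !inE => /orP[] /eqP -> /orP[] /eqP -> //;
  by rewrite ?adj_irrefl // adj_sym.
Qed.

(** * Counting pentagons through an arc *)

(** Any two vertices two steps apart on a closed walk of length 5 have a common
    neighbour on it, so in a triangle-free graph they are not adjacent.  All
    adjacencies are then those of the 5-cycle, and this already forces the five
    vertices to be distinct. *)
Lemma walk5_pentagon (a b c d e : G) :
  adj a b -> adj b c -> adj c d -> adj d e -> adj e a ->
  is_pentagon [set x in [:: a; b; c; d; e]].
Proof.
move=> ab bc cd de ea; apply/pentagonP.
have [ba cb] : adj b a /\ adj c b by split; rewrite adj_sym.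
have [dc ed] : adj d c /\ adj e d by split; rewrite adj_sym.
have ae : adj a e by rewrite adj_sym.
pose p (i : 'I_5) := nth a [:: a; b; c; d; e] i.
have homp i j : adj (p i) (p j) = cycle_rel i j.
  case: i j => [[|[|[|[|[|i]]]]] // iP] [[|[|[|[|[|j]]]]] // jP];
    rewrite /p /= ?adj_irrefl //.
  - exact: triangle_free ba bc.
  - exact: triangle_free ea ed.
  - exact: triangle_free cb cd.
  - exact: triangle_free ab ae.
  - exact: triangle_free bc ba.
  - exact: triangle_free dc de.
  - exact: triangle_free ed ea.
  - exact: triangle_free cd cb.
  - exact: triangle_free ae ab.
  - exact: triangle_free de dc.
exists p; split=> // [i j pij|].
  by apply: C5_twin_free => k; rewrite -!homp pij.
apply/setP => x; rewrite inE; apply/idP/imsetP => [xs|[i _ ->]]; last exact: mem_nth.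
have ix : index x [:: a; b; c; d; e] < 5 by rewrite -index_mem in xs.
by exists (Ordinal ix); rewrite // /p nth_index.
Qed.

(** The ends of a path of length 3 are not equal (that would be a triangle) and
    not adjacent (that would be a 4-cycle, giving [b] and [d] the two common
    neighbours [a] and [c]). *)
Lemma walk3_common_nbr (a b c d : G) :
  adj a b -> adj b c -> adj c d -> a != c -> b != d ->
  exists e, nbr a :&: nbr d = [set e].
Proof.
move=> ab bc cd nac nbd; have cb : adj c b by rewrite adj_sym.
have ba : adj b a by rewrite adj_sym.
apply: common_nbr.
  by apply/eqP => ad; have := triangle_free bc ba; rewrite ad cd.
apply/negP => ad; have nbd' : ~~ adj b d by rewrite (triangle_free cb cd).
have [z zP] := common_nbr nbd nbd'.
have : a \in nbr b :&: nbr d by rewrite !inE ba adj_sym.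
have : c \in nbr b :&: nbr d by rewrite !inE bc adj_sym.
by rewrite zP !inE => /eqP cz /eqP az; rewrite cz az eqxx in nac.
Qed.

(** The pentagon through the path [q.1 b c q.2]; the intersection is the
    singleton of its fifth vertex, so that no choice is needed to name it. *)
Definition pentagon_of_walk (b c : G) (q : G * G) : {set G} :=
  [set q.1; b; c; q.2] :|: (nbr q.1 :&: nbr q.2).

(** [pentagon_of_walk b c] is a bijection from the pairs of extensions of the arc
    at its two ends to the pentagons through it.  It is injective because on the
    pentagon the only neighbour of [b] besides [c] is [a], and similarly for
    [c]; it is surjective by [C5_arc]. *)
Lemma card_pentagons_arc (b c : G) : adj b c ->
  #|[set J : {set G} | is_pentagon J & (b \in J) && (c \in J)]| = (r - 1) ^ 2.
Proof.
move=> bc; have cb : adj c b by rewrite adj_sym.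
pose W := setX (nbr b :\ c) (nbr c :\ b).
have cardW : #|W| = (r - 1) ^ 2.
  have := cardsD1 c (nbr b); have := cardsD1 b (nbr c).
  rewrite !card_nbr !inE bc cb cardsX !add1n => hc hb.
  by rewrite -mulnn {1}hb {1}hc !subn1.
have WP a d : (a, d) \in W ->
  [/\ adj b a, adj c d, a != c & b != d].
  by rewrite !inE /= => /andP[/andP[-> ->] /andP[nb ->]]; rewrite eq_sym.
have Wcommon a d : (a, d) \in W -> exists e, nbr a :&: nbr d = [set e].
  case/WP=> ba cd nac nbd.
  by apply: (walk3_common_nbr _ bc cd nac nbd); rewrite adj_sym.
have phiE a d : (a, d) \in W -> exists e, [/\ adj a e, adj d e
    & pentagon_of_walk b c (a, d) = [set x in [:: a; b; c; d; e]]].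
  move=> adW; have [e he] := Wcommon a d adW.
  have : e \in nbr a :&: nbr d by rewrite he inE.
  rewrite !inE => /andP[ae de]; exists e; split=> //.
  by apply/setP => x; rewrite /pentagon_of_walk he !inE /= -!orbA.
have phi_nbr a d x : (a, d) \in W -> x \in pentagon_of_walk b c (a, d) ->
    (x \in nbr b :\ c -> x = a) /\ (x \in nbr c :\ b -> x = d).
  move=> adW; have [e [ae de ->]] := phiE a d adW; case/WP: adW => ba cd nac nbd.
  have ab : adj a b by rewrite adj_sym.
  have dc : adj d c by rewrite adj_sym.
  have bd := triangle_free cb cd; have be := triangle_free ab ae.
  have ca := triangle_free bc ba; have ce := triangle_free dc de.
  rewrite !inE => /or4P[||| /orP[]] /eqP->;
    by rewrite ?eqxx ?adj_irrefl ?bd ?be ?ca ?ce ?andbF; split.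
rewrite -cardW -(card_in_imset (f := pentagon_of_walk b c)); last first.
  case=> [a d] [a' d'] adW adW' E.
  have a'J : a' \in pentagon_of_walk b c (a, d) by rewrite E !inE eqxx.
  have d'J : d' \in pentagon_of_walk b c (a, d) by rewrite E !inE eqxx !orbT.
  move: adW'; rewrite inE /= => /andP[a'b d'c].
  by rewrite ((phi_nbr _ _ _ adW a'J).1 a'b) ((phi_nbr _ _ _ adW d'J).2 d'c).
apply: eq_card => J; rewrite inE; apply/and3P/imsetP => [[pJ bJ cJ]|[[a d] adW ->]].
  have [p [injp eJ homp]] := (pentagonP J).1 pJ.
  move: bJ cJ; rewrite eJ => /imsetP[i _ eb] /imsetP[j _ ec].
  have [|i' [j' [k [/and4P[ii' jj' i'k j'k] i'j j'i allk]]]] := @C5_arc i j.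
    by rewrite -homp -eb -ec.
  have adW : (p i', p j') \in W.
    by rewrite !inE /= eb ec !(inj_eq injp) !homp i'j j'i ii' jj'.
  exists (p i', p j') => //; have [e [i'e j'e ->]] := phiE _ _ adW.
  have [z hz] := Wcommon _ _ adW.
  have -> : e = p k.
    have : e \in nbr (p i') :&: nbr (p j') by rewrite !inE i'e.
    have : p k \in nbr (p i') :&: nbr (p j') by rewrite !inE !homp i'k.
    by rewrite hz !inE => /eqP -> /eqP.
  apply/setP => x; rewrite inE eb ec -[[:: _; _; _; _; _]]/(map p [:: i'; i; j; j'; k]).
  by apply/imsetP/mapP => -[l lP ->]; exists l.
have [e [ae de ->]] := phiE a d adW; case/WP: adW => ba cd nac nbd.
split; try by rewrite !inE eqxx ?orbT.
by apply: walk5_pentagon; rewrite // adj_sym.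
Qed.

(** Double counting of the pairs of a pentagon and one of its arcs. *)
Lemma num_pentagons_arcs : 10 * num_pentagons G = #|G| * r * (r - 1) ^ 2.
Proof.
have arcs : #|[set q : G * G | adj q.1 q.2]| = #|G| * r.
  by rewrite card_rel (eq_bigr (fun=> r)) ?sum_nat_const // => x _; exact: card_nbr.
rewrite -arcs -sum_nat_const mulnC /num_pentagons -sum_nat_const.
transitivity (\sum_(J in [set J : {set G} | is_pentagon J])
   \sum_(q : G * G | adj q.1 q.2 && ((q.1 \in J) && (q.2 \in J))) 1).
  apply: eq_bigr => J; rewrite inE => /card_pentagon_arcs <-; rewrite -sum1_card.
  by apply: eq_bigl => q; rewrite inE.
rewrite (exchange_big_dep (fun q : G * G => adj q.1 q.2)) /=; last first.
  by move=> J q _ /andP[].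
apply: eq_big => [q|q qadj]; first by rewrite inE.
rewrite -(card_pentagons_arc qadj) -sum1_card; apply: eq_bigl => J.
by rewrite !inE qadj.
Qed.

End Moore.

(** * The formulas in the integers *)

Import GRing.Theory.
Local Open Scope ring_scope.

(** For [n < k] the product has the factor [n - n], so the integer formula agrees
    with the truncated one. *)
Lemma ffactZ (n k : nat) : (n ^_ k)%:Z = \prod_(i < k) (n%:Z - i%:Z).
Proof.
elim: k => [|k IHk]; first by rewrite big_ord0 ffactn0.
rewrite big_ord_recr /= -IHk ffactnSr PoszM; have [nk|kn] := ltnP n k.
  by rewrite ffact_small // !mul0r.
by rewrite subzn.
Qed.

Lemma binZ (n k : nat) : 'C(n, k)%:Z * k`!%:Z = \prod_(i < k) (n%:Z - i%:Z).
Proof. by rewrite -ffactZ -bin_ffact PoszM. Qed.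

Lemma bin2Z (n : nat) : 'C(n, 2)%:Z * 2 = n%:Z * (n%:Z - 1).
Proof. by rewrite -[2]/(2`!%:Z) binZ !big_ord_recr big_ord0 /= mul1r subr0. Qed.

Lemma bin3Z (n : nat) : 'C(n, 3)%:Z * 6 = n%:Z * (n%:Z - 1) * (n%:Z - 2).
Proof. by rewrite -[6]/(3`!%:Z) binZ !big_ord_recr big_ord0 /= mul1r subr0. Qed.

Lemma bin4Z (n : nat) :
  'C(n, 4)%:Z * 24 = n%:Z * (n%:Z - 1) * (n%:Z - 2) * (n%:Z - 3).
Proof. by rewrite -[24]/(4`!%:Z) binZ !big_ord_recr big_ord0 /= mul1r subr0. Qed.

Lemma moore_num_indep3 (G : sgraph) (r : nat) (x : G) :
  strongly_regular G r 0 1 ->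
  6 * (num_indep G 3)%:Z = #|G|%:Z * r%:Z ^+ 2 * (r%:Z - 1) * (r%:Z - 2).
Proof.
move=> srgG; have hn := moore_order srgG x.
have h2 := num_indep2 srgG; have h3 := num_indep3 srgG.
nia.
Qed.

Lemma moore_num_indep4 (G : sgraph) (r : nat) (x : G) :
  strongly_regular G r 0 1 ->
  24 * (num_indep G 4)%:Z = #|G|%:Z * r%:Z * (r%:Z - 1) * (r%:Z - 2)
    * (r%:Z * (r%:Z ^+ 2 + 1 - 3 * r%:Z) - 1).
Proof.
move=> srgG; have hn : #|G|%:Z = r%:Z ^+ 2 + 1 by rewrite (moore_order srgG x); lia.
have h3 := moore_num_indep3 x srgG.
have h4 : 4 * (num_indep G 4)%:Z
    = (#|G|%:Z - 3 * r%:Z) * (num_indep G 3)%:Z - #|G|%:Z * 'C(r, 3)%:Z.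
  by have := num_indep4 srgG; lia.
have hC := bin3Z r.
have -> : 24 * (num_indep G 4)%:Z = 6 * (4 * (num_indep G 4)%:Z) by ring.
rewrite h4 mulrBr mulrCA h3 [6 * (_ * _)]mulrCA [6 * 'C(_, _)%:Z]mulrC hC hn.
by ring.
Qed.

Lemma moore_num_edges (G : sgraph) (r : nat) :
  strongly_regular G r 0 1 -> 2 * #|edges G|%:Z = #|G|%:Z * r%:Z.
Proof.
move=> srgG; have h2 := num_indep2 srgG; have he := num_indep2_edges G.
have hC := bin2Z #|G|.
by set n := #|G| in h2 he hC *; clear srgG; lia.
Qed.

Theorem theorem5p1 :
  (forall (r : nat) (G : sgraph),
     regular G r -> has_girth G 5 -> has_diameter G 2 ->
     let n := #|G| in
     let m := #|edges G| in
     (num_indep G 3)%:Z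
       = 'C(n, 3)%:Z - (n%:Z - 2) * m%:Z + n%:Z * 'C(r, 2)%:Z
     /\
     (num_indep G 4)%:Z
       = 'C(n, 4)%:Z - 'C(n - 2, 2)%:Z * m%:Z
         + n%:Z * (n%:Z - 4) * 'C(r, 2)%:Z - n%:Z * 'C(r, 3)%:Z
         + 'C(m, 2)%:Z - m%:Z * (r%:Z - 1) ^+ 2)
  /\
  (forall G : sgraph,
     regular G 57 -> has_diameter G 2 -> has_girth G 5 ->
     [/\ num_pentagons G = (2 ^ 6 * 3 * 5 ^ 2 * 7 ^ 2 * 13 * 19)%N,
         num_indep G 3 = (2 ^ 3 * 3 * 5 ^ 4 * 7 * 11 * 13 * 19 ^ 2)%N
       & num_indep G 4
           = (2 ^ 2 * 5 ^ 4 * 7 * 11 * 13 * 19 * 87751)%N]).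
Proof.
split=> [r G regG girthG diamG n m|G regG diamG girthG]; last first.
  have srgG := moore_strongly_regular regG girthG diamG.
  have [_ [x _]] := diamG.
  have hn := moore_order srgG x; have h3 := moore_num_indep3 x srgG.
  have h4 := moore_num_indep4 x srgG; have h5 := num_pentagons_arcs srgG.
  split.
  - by move: h5; rewrite hn; clear; lia.
  - by move: h3; rewrite hn; clear; lia.
  - (* The Horner form of the decimal literal spares building 87751 successors. *)
    cbn [Nat.of_num_uint Nat.of_uint Nat.of_uint_acc].
    rewrite !PeanoNat.Nat.tail_mul_spec.
    by move: h4; rewrite hn; clear; lia.
have srgG := moore_strongly_regular regG girthG diamG.
have [_ [x _]] := diamG.
have hn : n%:Z = r%:Z ^+ 2 + 1 by rewrite /n (moore_order srgG x); lia.
have hm : 2 * m%:Z = n%:Z * r%:Z := moore_num_edges srgG.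
have h3 := moore_num_indep3 x srgG; have h4 := moore_num_indep4 x srgG.
(* Needed to read the truncated [n - 2] as an integer; a 5-cycle has 5 vertices. *)
have n2 : (2 <= n)%N.
  have [[c /and3P[c2 uc _] _] _] := girthG.
  by rewrite /n (leq_trans (ltnW c2)) // -(card_uniqP uc) max_card.
have n2Z : (n - 2)%N%:Z = n%:Z - 2 by lia.
rewrite -/n in h3 h4; split.
  apply: (mulfI (_ : 6%:Z != 0)) => //; rewrite h3.
  have -> : 6 * ('C(n, 3)%:Z - (n%:Z - 2) * m%:Z + n%:Z * 'C(r, 2)%:Z)
    = 'C(n, 3)%:Z * 6 - 3 * (n%:Z - 2) * (2 * m%:Z)
      + 3 * n%:Z * ('C(r, 2)%:Z * 2) by ring.
  by rewrite bin3Z bin2Z hm hn; ring.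
apply: (mulfI (_ : 24%:Z != 0)) => //; rewrite h4.
have -> : 24 * ('C(n, 4)%:Z - 'C(n - 2, 2)%:Z * m%:Z
         + n%:Z * (n%:Z - 4) * 'C(r, 2)%:Z - n%:Z * 'C(r, 3)%:Z
         + 'C(m, 2)%:Z - m%:Z * (r%:Z - 1) ^+ 2)
   = 'C(n, 4)%:Z * 24 - 6 * ('C(n - 2, 2)%:Z * 2) * (2 * m%:Z)
     + 12 * n%:Z * (n%:Z - 4) * ('C(r, 2)%:Z * 2)
     - 4 * n%:Z * ('C(r, 3)%:Z * 6) + 12 * ('C(m, 2)%:Z * 2)
     - 12 * (2 * m%:Z) * (r%:Z - 1) ^+ 2 by ring.
rewrite bin4Z bin3Z !bin2Z n2Z.
have -> : 12 * (m%:Z * (m%:Z - 1)) = 3 * (2 * m%:Z) * (2 * m%:Z - 2) by ring.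
by rewrite hm hn; ring.
Qed.
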